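(* Let $p\ge1$ be an integer and let $f$ be a $p$-harmonic mapping of $\mathbb{D}$ satisfying $f(z)=|z|^{2(p-1)}G(z)$, where $G$ is harmonic, orientation preserving and starlike. Then $f$ is starlike univalent.
   Context: $\mathbb{D}=\{z\in\mathbb{C}:|z|<1\}$. A $2p$-times continuously differentiable complex-valued function $f$ on $\mathbb{D}$ is $p$-harmonic if $\Delta^p f=0$, where $\Delta=4\frac{\partial^2}{\partial z\partial\overline z}$ and $\Delta^p$ is its $p$-fold iterate; harmonic means $1$-harmonic (complex-valued). For a $C^1$ function $f$, $Df=zf_z-\overline{z}f_{\overline z}$. For a sense-preserving (orientation preserving) $C^1$-mapping the Jacobian is $J_f=|f_z|^2-|f_{\overline z}|^2>0$. Starlike: a $C^1$-mapping $f$ with $f(0)=0$ is called starlike if $f$ maps $\mathbb{D}$ univalently onto a domain $\Omega$ that is starlike with respect to the origin, i.e. for every $w\in\Omega$ the segment $[0,w]$ lies in $\Omega$. It is known that $f$ is starlike if it is sense-preserving, $f(0)=0$, $f(z)\ne0$ for $z\in\mathbb{D}\setminus\{0\}$ and $\frac{\partial}{\partial t}\big(\arg f(re^{it})\big):=\mathrm{Re}\left(\frac{Df(z)}{f(z)}\right)>0$ for all $z=re^{it}\in\mathbb{D}\setminus\{0\}$.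
   Formalization: ''Starlike'' here also requires Re(Df/f)>0 on D\{0}, assumed of G and proved for f; with the geometric definition alone the claim fails: for G the harmonic Koebe map, |z|^{2(p-1)}G is not univalent when p≥6. *)

(* Defs.v *)
(* Stdlib reals with Coquelicot's complex numbers. *)
From Stdlib Require Import Reals.
From Coquelicot Require Export Coquelicot.

Open Scope R_scope.
Open Scope C_scope.

Definition disk (z : C) : Prop := Cmod z < 1.

(* Functions on the disk are total functions [C -> C] of which only the values
   on [disk] matter: the disk is open, so all the (iterated) partial
   derivatives below, taken at points of the disk, depend on these values only. *)

Definition deriv_x (f : C -> C) (z : C) : C :=
  (Derive (fun s : R => Re (f (s, Im z))) (Re z),
   Derive (fun s : R => Im (f (s, Im z))) (Re z)).

Definition deriv_y (f : C -> C) (z : C) : C :=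
  (Derive (fun s : R => Re (f (Re z, s))) (Im z),
   Derive (fun s : R => Im (f (Re z, s))) (Im z)).

Definition deriv_z (f : C -> C) (z : C) : C :=
  (deriv_x f z - Ci * deriv_y f z) / 2.

Definition deriv_zbar (f : C -> C) (z : C) : C :=
  (deriv_x f z + Ci * deriv_y f z) / 2.

Definition laplacian (f : C -> C) (z : C) : C :=
  4 * deriv_z (deriv_zbar f) z.

(* [ex_diff_n u n x y] asks for continuity at the point (x, y) of all partial
   derivatives of u of order at most n; required at every point of the disk,
   this is the class C^n. *)
Definition class_Cn (n : nat) (f : C -> C) : Prop :=
  forall z, disk z ->
    ex_diff_n (fun x y : R => Re (f (x, y))) n (Re z) (Im z) /\
    ex_diff_n (fun x y : R => Im (f (x, y))) n (Re z) (Im z).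

Definition p_harmonic (p : nat) (f : C -> C) : Prop :=
  class_Cn (2 * p) f /\ forall z, disk z -> Nat.iter p laplacian f z = 0.

Definition harmonic (f : C -> C) : Prop := p_harmonic 1 f.

Definition jacobian (f : C -> C) (z : C) : R :=
  (Cmod (deriv_z f z) ^ 2 - Cmod (deriv_zbar f z) ^ 2)%R.

Definition sense_preserving (f : C -> C) : Prop :=
  class_Cn 1 f /\ forall z, disk z -> (0 < jacobian f z)%R.

Definition univalent (f : C -> C) : Prop :=
  forall z w, disk z -> disk w -> f z = f w -> z = w.

Definition connected_set (A : C -> Prop) : Prop :=
  forall U V : C -> Prop, open U -> open V ->
    (forall z, A z -> U z \/ V z) ->
    (exists z, A z /\ U z) -> (exists z, A z /\ V z) ->
    exists z, A z /\ U z /\ V z.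

Definition domain (A : C -> Prop) : Prop :=
  (exists z, A z) /\ open A /\ connected_set A.

Definition image_disk (f : C -> C) (w : C) : Prop :=
  exists z, disk z /\ f z = w.

Definition starlike_set (A : C -> Prop) : Prop :=
  forall w, A w -> forall t : R, (0 <= t <= 1)%R -> A (RtoC t * w).

Definition maps_onto_starlike_domain (f : C -> C) : Prop :=
  univalent f /\ domain (image_disk f) /\ starlike_set (image_disk f).

Definition opD (f : C -> C) (z : C) : C :=
  z * deriv_z f z - Cconj z * deriv_zbar f z.

(* Re (Df(z) / f(z)) is the derivative of arg f(r e^{it}) with respect to t
   at z = r e^{it}. *)
Definition arg_increasing_on_circles (f : C -> C) : Prop :=
  forall z, disk z -> z <> 0 -> f z <> 0 /\ (0 < Re (opD f z / f z))%R.

(* For conformal maps the last clause follows from the others.  For harmonic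
   maps it does not: the harmonic Koebe map sends the disk univalently onto the
   plane slit along (-oo, -1/6], yet Re (Df/f) < 0 at some points.  There, the
   Jacobian of |z|^(2m) f, which is
     |z|^(4m) (J_f + 2 m |f|^2 |z|^(-2) Re (Df/f)),
   is negative for large m, although it is positive near 0 off the origin: so
   multiplication by |z|^(2m) can destroy univalence if that clause is omitted. *)
Definition starlike (f : C -> C) : Prop :=
  class_Cn 1 f /\ f 0 = 0 /\
  maps_onto_starlike_domain f /\ arg_increasing_on_circles f.

(* Main.v *)
(** Let H be the inverse of G on the starlike domain G(D).  Since J_G > 0 it is
    continuous and differentiable, and the condition Re (DG / G) > 0 says exactly
    that |H(t w)| increases with t > 0.  With m = p - 1, the map f carries H(w) to
    |H(w)|^(2m) w: it stays on the ray of w, and its modulus increases strictly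
    along that ray.  Hence f is injective and, by the intermediate value
    theorem, its image contains the segment from 0 to each of its points; the
    image is open because any point of it is followed by a farther image point
    on every nearby ray.  Finally D kills radial factors, so Df / f = DG / G. *)
Require Import Defs.
From Stdlib Require Import Reals Lra Psatz ClassicalEpsilon.
From Coquelicot Require Import Coquelicot.
Open Scope R_scope.

(** * Elementary estimates for the complex modulus *)

Lemma Cmod_le_Rabs (c : C) : Cmod c <= Rabs (Re c) + Rabs (Im c).
Proof.
  pose proof (Cmod2_alt c) as E.
  pose proof (Cmod_ge_0 c). pose proof (Rabs_pos (Re c)).
  pose proof (Rabs_pos (Im c)).
  rewrite <- (pow2_abs (Re c)), <- (pow2_abs (Im c)) in E.
  nra.
Qed.

Lemma im_le_Cmod (c : C) : Rabs (Im c) <= Cmod c.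
Proof.
  eapply Rle_trans; [apply Rmax_r|apply Rmax_Cmod].
Qed.

Lemma Cmod_minus_sym (z w : C) : Cmod (z - w) = Cmod (w - z).
Proof.
  replace (w - z)%C with (- (z - w))%C by ring.
  now rewrite Cmod_opp.
Qed.

Lemma Cmod_triangle_minus (x y z : C) :
  Cmod (x - z) <= Cmod (x - y) + Cmod (y - z).
Proof.
  replace (x - z)%C with ((x - y) + (y - z))%C by ring.
  apply Cmod_triangle.
Qed.

Lemma Cmod_minus_lower (x y : C) : Cmod x - Cmod y <= Cmod (x - y).
Proof.
  pose proof (Cmod_triangle (x - y) y) as H.
  replace (x - y + y)%C with x in H by ring.
  lra.
Qed.

Lemma Cmod_small_eq_0 (c : C) :
  (forall eps, 0 < eps -> Cmod c <= eps) -> c = 0.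
Proof.
  intros H. apply Cmod_eq_0.
  destruct (Rle_lt_or_eq_dec _ _ (Cmod_ge_0 c)) as [h|h]; [|easy].
  specialize (H (Cmod c / 2)). lra.
Qed.

(** * Completeness of the plane and the contraction principle *)

(** The real and imaginary parts telescope into series dominated by a geometric one; completeness of
    the reals is applied to each coordinate. *)
Lemma C_cauchy_geometric (u : nat -> C) (r : R) :
  (forall n, Cmod (u (S n) - u n) <= r * (/ 2) ^ n) ->
  exists l : C, forall eps, 0 < eps ->
    exists N, forall n, (N <= n)%nat -> Cmod (u n - l) <= eps.
Proof.
  intros H.
  assert (Hc : forall g : C -> R,
    (forall z w, g (z - w)%C = g z - g w) -> (forall z, Rabs (g z) <= Cmod z) ->
    exists l : R, is_lim_seq (fun n => g (u n)) l).
  { intros g Hg Hle.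
    assert (Hs : ex_series (fun n => g (u (S n)) - g (u n))).
    { apply (ex_series_le (V := R_CompleteNormedModule) _ (fun n => r * (/ 2) ^ n)).
      - intros n. rewrite <- Hg. eapply Rle_trans; [apply Hle|apply H].
      - apply (ex_series_scal_l r (fun n => (/ 2) ^ n)), ex_series_geom.
        rewrite Rabs_pos_eq; lra. }
    destruct Hs as [l Hl].
    exists (l + g (u O)).
    apply is_lim_seq_incr_1.
    apply is_lim_seq_ext with
      (fun n => sum_n (fun n => g (u (S n)) - g (u n)) n + g (u O)).
    - intros n. induction n as [|n IH].
      + rewrite sum_O. ring.
      + rewrite sum_Sn. change plus with Rplus. lra.
    - apply is_lim_seq_plus'; [exact Hl|apply is_lim_seq_const]. }
  destruct (Hc Re) as [a Ha]; [reflexivity|apply re_le_Cmod|].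
  destruct (Hc Im) as [b Hb]; [reflexivity|apply im_le_Cmod|].
  exists (a, b). intros eps He.
  apply is_lim_seq_spec in Ha. apply is_lim_seq_spec in Hb.
  assert (He2 : 0 < eps / 2) by lra.
  destruct (Ha (mkposreal _ He2)) as [N1 H1].
  destruct (Hb (mkposreal _ He2)) as [N2 H2].
  exists (max N1 N2). intros n Hn.
  eapply Rle_trans; [apply Cmod_le_Rabs|].
  specialize (H1 n ltac:(lia)). specialize (H2 n ltac:(lia)).
  simpl in H1, H2. change (Rabs (Re (u n) - a) + Rabs (Im (u n) - b) <= eps). lra.
Qed.

(** Banach iteration from [z0]. [T] need not preserve the ball: a first step of length at most r/2
    and the ratio 1/2 keep the iterates within r of [z0]. *)
Lemma contraction_fixpoint (T : C -> C) (z0 : C) (r : R) :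
  0 < r ->
  (forall z w, Cmod (z - z0) <= r -> Cmod (w - z0) <= r ->
     Cmod (T z - T w) <= / 2 * Cmod (z - w)) ->
  Cmod (T z0 - z0) <= r / 2 ->
  exists z, Cmod (z - z0) <= r /\ T z = z.
Proof.
  intros Hr HT H0.
  set (u := fun n => Nat.iter n T z0).
  (* The bound r (1 - 2^-n) is the sum of the first n step bounds (r/2) 2^-k. Both halves go through
     one induction, since the contraction estimate applies only to iterates in the ball. *)
  assert (Hu : forall n, Cmod (u n - z0) <= r * (1 - (/ 2) ^ n) /\
                         Cmod (u (S n) - u n) <= r / 2 * (/ 2) ^ n).
  { induction n as [|n [IH1 IH2]].
    - simpl. replace (z0 - z0)%C with (RtoC 0) by ring. rewrite Cmod_0. lra.
    - assert (Hp : 0 < (/ 2) ^ n) by (apply pow_lt; lra).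
      assert (H1 : Cmod (u (S n) - z0) <= r * (1 - (/ 2) ^ S n)).
      { pose proof (Cmod_triangle_minus (u (S n)) (u n) z0). simpl pow in *. nra. }
      split; [exact H1|].
      change (u (S (S n))) with (T (u (S n))).
      change (u (S n)) with (T (u n)) at 2.
      assert (0 < (/ 2) ^ S n) by (apply pow_lt; lra).
      eapply Rle_trans; [apply HT; nra|]. simpl pow in *. lra. }
  destruct (C_cauchy_geometric u (r / 2)) as [z Hz]; [apply Hu|].
  assert (Hz0 : Cmod (z - z0) <= r).
  { apply Rle_plus_epsilon. intros eps He.
    destruct (Hz eps He) as [N HN]. specialize (HN N (le_n N)).
    pose proof (Cmod_triangle_minus z (u N) z0).
    rewrite Cmod_minus_sym in HN.
    destruct (Hu N) as [h _].
    assert (Hp : 0 < (/ 2) ^ N) by (apply pow_lt; lra). nra. }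
  exists z. split; [exact Hz0|].
  apply Ceq_minus, Cmod_small_eq_0. intros eps He.
  destruct (Hz (eps / 2)) as [N HN]; [lra|].
  pose proof (HN N (le_n N)) as h1. pose proof (HN (S N) ltac:(lia)) as h2.
  destruct (Hu N) as [h _].
  assert (Hp : 0 < (/ 2) ^ N) by (apply pow_lt; lra).
  assert (h3 : Cmod (T z - T (u N)) <= / 2 * Cmod (z - u N)).
  { apply HT; nra. }
  pose proof (Cmod_triangle_minus (T z) (u (S N)) z).
  change (T (u N)) with (u (S N)) in h3.
  rewrite Cmod_minus_sym in h1. lra.
Qed.

(** * Real-linear maps of the plane, strict differentiability and local openness *)

(** The general form of a real-linear map of the plane, with determinant |a|^2 - |b|^2; for a
    differential, a and b are the two Wirtinger derivatives. *)
Definition real_linear (a b h : C) : C := (a * h + b * Cconj h)%C.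

(** Both points vary near [z0], so F minus its linear part has a small Lipschitz constant there;
    this is what makes the Newton map below a contraction. *)
Definition strictly_differentiable (F : C -> C) (z0 a b : C) : Prop :=
  forall eps, 0 < eps -> exists del, 0 < del /\
    forall z w, Cmod (z - z0) < del -> Cmod (w - z0) < del ->
      Cmod (F w - F z - real_linear a b (w - z)) <= eps * Cmod (w - z).

Lemma real_linear_minus (a b h k : C) :
  (real_linear a b (h - k) = real_linear a b h - real_linear a b k)%C.
Proof. unfold real_linear. rewrite Cminus_conj. ring. Qed.

Definition inv_jac (a b : C) : C := RtoC (/ (Cmod a ^ 2 - Cmod b ^ 2)).

(** Cramer's rule for k = a h + b conj h together with its conjugate equation: h = (conj a k - b
    conj k) / (|a|^2 - |b|^2). *)
Definition real_linear_inv (a b k : C) : C :=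
  real_linear (Cconj a * inv_jac a b) (- b * inv_jac a b) k.

Lemma real_linear_inv_minus (a b h k : C) :
  (real_linear_inv a b (h - k) = real_linear_inv a b h - real_linear_inv a b k)%C.
Proof. apply real_linear_minus. Qed.

Lemma jac_inv (a b : C) : 0 < Cmod a ^ 2 - Cmod b ^ 2 ->
  ((a * Cconj a - b * Cconj b) * inv_jac a b = 1)%C.
Proof.
  intros HJ. unfold inv_jac.
  rewrite <- !Cmod2_conj, <- RtoC_minus, <- RtoC_mult.
  f_equal. field. lra.
Qed.

Lemma real_linear_invK (a b h : C) : 0 < Cmod a ^ 2 - Cmod b ^ 2 ->
  real_linear_inv a b (real_linear a b h) = h.
Proof.
  intros HJ. pose proof (jac_inv a b HJ) as E.
  unfold real_linear_inv, real_linear.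
  rewrite Cplus_conj, !Cmult_conj, Cconj_conj.
  transitivity ((a * Cconj a - b * Cconj b) * inv_jac a b * h)%C; [ring|].
  rewrite E. ring.
Qed.

Lemma Cconj_RtoC (x : R) : Cconj (RtoC x) = RtoC x.
Proof. unfold Cconj, RtoC; simpl. now rewrite Ropp_0. Qed.

Lemma real_linear_invK' (a b k : C) : 0 < Cmod a ^ 2 - Cmod b ^ 2 ->
  real_linear a b (real_linear_inv a b k) = k.
Proof.
  intros HJ. pose proof (jac_inv a b HJ) as E.
  unfold real_linear_inv, real_linear.
  rewrite Cplus_conj, !Cmult_conj, Copp_conj, !Cconj_conj.
  unfold inv_jac in *. rewrite Cconj_RtoC.
  set (j := RtoC _) in *.
  transitivity ((a * Cconj a - b * Cconj b) * j * k)%C; [ring|].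
  rewrite E. ring.
Qed.

Lemma real_linear_bound (a b h : C) :
  Cmod (real_linear a b h) <= (Cmod a + Cmod b) * Cmod h.
Proof.
  unfold real_linear. eapply Rle_trans; [apply Cmod_triangle|].
  rewrite !Cmod_mult, Cmod_conj. lra.
Qed.

Lemma real_linear_inv_bounded (a b : C) :
  exists M, 0 < M /\ forall k, Cmod (real_linear_inv a b k) <= M * Cmod k.
Proof.
  exists (Cmod (Cconj a * inv_jac a b) + Cmod (- b * inv_jac a b) + 1).
  split.
  - pose proof (Cmod_ge_0 (Cconj a * inv_jac a b)).
    pose proof (Cmod_ge_0 (- b * inv_jac a b)). lra.
  - intros k. eapply Rle_trans; [apply real_linear_bound|].
    pose proof (Cmod_ge_0 k). nra.
Qed.

(** Simplified Newton method: with L the differential at [z0], the solutions of F z = w are the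
    fixed points of z - L^-1 (F z - w), a contraction near [z0]. *)
Lemma strictly_differentiable_open (F : C -> C) (z0 a b : C) :
  0 < Cmod a ^ 2 - Cmod b ^ 2 -> strictly_differentiable F z0 a b ->
  forall eps, 0 < eps -> exists del, 0 < del /\
    forall w, Cmod (w - F z0) < del -> exists z, Cmod (z - z0) < eps /\ F z = w.
Proof.
  intros HJ HF eps He.
  destruct (real_linear_inv_bounded a b) as [M [HM HL]].
  (* As M bounds L^-1, the tolerance 1/(2M) gives the contraction ratio 1/2; the radius r/(2M)
     chosen below for w likewise bounds the first Newton step by r/2. *)
  destruct (HF (/ 2 * / M)) as [d [Hd Hs]].
  { apply Rmult_lt_0_compat; [lra|now apply Rinv_0_lt_compat]. }
  set (r := Rmin d eps / 2).
  assert (Hr : 0 < r /\ r < d /\ r < eps).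
  { unfold r. pose proof (Rmin_l d eps). pose proof (Rmin_r d eps).
    pose proof (Rmin_pos d eps Hd He). lra. }
  exists (r / 2 * / M). split.
  { apply Rmult_lt_0_compat; [lra|now apply Rinv_0_lt_compat]. }
  intros w Hw.
  set (T := fun z => (z - real_linear_inv a b (F z - w))%C).
  destruct (contraction_fixpoint T z0 r) as [z [Hz1 Hz2]].
  - lra.
  - intros z z' Hz Hz'.
    replace (T z - T z')%C with
      (- real_linear_inv a b (F z - F z' - real_linear a b (z - z')))%C.
    + rewrite Cmod_opp. eapply Rle_trans; [apply HL|].
      specialize (Hs z' z ltac:(lra) ltac:(lra)).
      apply (Rmult_le_compat_l M) in Hs; [|lra].
      eapply Rle_trans; [exact Hs|].
      apply Req_le. field. lra.
    + unfold T.
      replace (F z - F z' - real_linear a b (z - z'))%C with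
        ((F z - w) - (F z' - w) - real_linear a b (z - z'))%C by ring.
      rewrite !real_linear_inv_minus, !real_linear_invK by exact HJ. ring.
  - unfold T. replace (z0 - real_linear_inv a b (F z0 - w) - z0)%C with
      (- real_linear_inv a b (F z0 - w))%C by ring.
    rewrite Cmod_opp. eapply Rle_trans; [apply HL|].
    rewrite Cmod_minus_sym.
    apply (Rmult_lt_compat_l M), Rlt_le in Hw; [|lra].
    eapply Rle_trans; [exact Hw|].
    apply Req_le. field. lra.
  - exists z. split; [lra|].
    assert (E : real_linear_inv a b (F z - w) = 0).
    { transitivity (z - T z)%C; [unfold T; ring|]. rewrite Hz2. ring. }
    apply Ceq_minus. rewrite <- (real_linear_invK' a b (F z - w) HJ), E.
    unfold real_linear, Cconj. simpl.
    apply injective_projections; simpl; ring.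
Qed.

(** * Strict differentiability of C^1 functions *)

(** The increment is split along the corner (x, y), (x, y'), (x', y'). The mean value theorem on
    each leg gives a partial derivative at a nearby point, close to its value at (x0, y0) by
    continuity. *)
Lemma strictly_differentiable_R2 (u : R -> R -> R) (x0 y0 : R) :
  locally_2d (fun x y => ex_diff_n u 1 x y) x0 y0 ->
  forall eps, 0 < eps -> exists del, 0 < del /\ forall x y x' y',
    Rabs (x - x0) < del -> Rabs (y - y0) < del ->
    Rabs (x' - x0) < del -> Rabs (y' - y0) < del ->
    Rabs (u x' y' - u x y - Derive (fun s => u s y0) x0 * (x' - x)
          - Derive (fun s => u x0 s) y0 * (y' - y))
      <= eps * (Rabs (x' - x) + Rabs (y' - y)).
Proof.
  intros [d0 H0] eps He.
  destruct (H0 x0 y0) as [_ [_ [_ [[H1 _] [H2 _]]]]];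
    try (rewrite Rminus_diag, Rabs_R0; apply cond_pos).
  destruct (H1 (mkposreal _ He)) as [d1 K1].
  destruct (H2 (mkposreal _ He)) as [d2 K2]. clear H1 H2. simpl in K1, K2.
  exists (Rmin d0 (Rmin d1 d2)). split.
  { repeat apply Rmin_pos; apply cond_pos. }
  intros x y x' y' Hx Hy Hx' Hy'.
  assert (Hm : forall t, t < Rmin d0 (Rmin d1 d2) -> t < d0 /\ t < d1 /\ t < d2).
  { intros t Ht. pose proof (Rmin_l d0 (Rmin d1 d2)).
    pose proof (Rmin_r d0 (Rmin d1 d2)).
    pose proof (Rmin_l d1 d2). pose proof (Rmin_r d1 d2). lra. }
  apply Hm in Hx, Hy, Hx', Hy'.
  assert (Hb : forall p q c p0 (d : posreal), Rmin p q <= c <= Rmax p q ->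
    Rabs (p - p0) < d -> Rabs (q - p0) < d -> Rabs (c - p0) < d).
  { intros p q c p0 d Hc Hp Hq. apply Rabs_def2 in Hp, Hq.
    apply Rabs_def1; revert Hc; unfold Rmin, Rmax; destruct (Rle_dec p q); lra. }
  destruct (MVT_gen (fun s => u s y') x x' (fun s => Derive (fun s => u s y') s))
    as [c [Hc Ec]].
  { intros c Hc. apply Derive_correct.
    destruct (H0 c y') as [_ [h _]]; [apply (Hb x x'); lra|lra|exact h]. }
  { intros c Hc. apply derivable_continuous_pt, ex_derive_Reals_0.
    destruct (H0 c y') as [_ [h _]]; [apply (Hb x x'); lra|lra|exact h]. }
  destruct (MVT_gen (fun s => u x s) y y' (fun s => Derive (fun s => u x s) s))
    as [e [Hd Ed]].
  { intros c' Hc'. apply Derive_correct.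
    destruct (H0 x c') as [_ [_ [h _]]]; [lra|apply (Hb y y'); lra|exact h]. }
  { intros c' Hc'. apply derivable_continuous_pt, ex_derive_Reals_0.
    destruct (H0 x c') as [_ [_ [h _]]]; [lra|apply (Hb y y'); lra|exact h]. }
  assert (B1 : Rabs (Derive (fun s => u s y') c - Derive (fun s => u s y0) x0) < eps).
  { apply (K1 c y'); [apply (Hb x x'); lra|lra]. }
  assert (B2 : Rabs (Derive (fun s => u x s) e - Derive (fun s => u x0 s) y0) < eps).
  { apply (K2 x e); [lra|apply (Hb y y'); lra]. }
  replace (u x' y' - u x y - _ - _) with
    ((Derive (fun s => u s y') c - Derive (fun s => u s y0) x0) * (x' - x) +
     (Derive (fun s => u x s) e - Derive (fun s => u x0 s) y0) * (y' - y)) by lra.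
  eapply Rle_trans; [apply Rabs_triang|]. rewrite !Rabs_mult.
  pose proof (Rabs_pos (x' - x)). pose proof (Rabs_pos (y' - y)). nra.
Qed.

Lemma disk_locally_2d (P : R -> R -> Prop) (z : C) :
  (forall w, disk w -> P (Re w) (Im w)) -> disk z ->
  locally_2d P (Re z) (Im z).
Proof.
  unfold disk. intros HP Hz.
  (* [locally_2d] uses squares: with half-side (1 - |z|)/2 the two coordinate increments sum to less
     than the distance 1 - |z| to the unit circle. *)
  assert (Hd : 0 < (1 - Cmod z) / 2) by lra.
  exists (mkposreal _ Hd). simpl. intros x y Hx Hy.
  apply (HP (x, y)).
  pose proof (Cmod_triangle ((x, y) - z) z) as h.
  replace ((x, y) - z + z)%C with ((x, y) : C) in h
    by (apply injective_projections; simpl; ring).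
  pose proof (Cmod_le_Rabs ((x, y) - z)) as h'.
  change (Re ((x, y) - z)) with (x - Re z) in h'.
  change (Im ((x, y) - z)) with (y - Im z) in h'. lra.
Qed.

Lemma class_C1_strictly_differentiable (F : C -> C) (z : C) :
  class_Cn 1 F -> disk z ->
  strictly_differentiable F z (deriv_z F z) (deriv_zbar F z).
Proof.
  intros HF Hz eps He.
  (* Two components, each with error eps/4 times a sum of two coordinate increments bounded by |w -
     z|: together eps |w - z|. *)
  destruct (strictly_differentiable_R2 (fun x y => Re (F (x, y))) (Re z) (Im z))
    with (eps := eps / 4) as [d1 [Hd1 K1]]; [|lra|].
  { apply disk_locally_2d; [|exact Hz]. intros w Hw. apply (HF w Hw). }
  destruct (strictly_differentiable_R2 (fun x y => Im (F (x, y))) (Re z) (Im z))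
    with (eps := eps / 4) as [d2 [Hd2 K2]]; [|lra|].
  { apply disk_locally_2d; [|exact Hz]. intros w Hw. apply (HF w Hw). }
  exists (Rmin d1 d2). split; [now apply Rmin_pos|].
  intros [x y] [x' y'] Hv Hw.
  pose proof (Rmin_l d1 d2). pose proof (Rmin_r d1 d2).
  pose proof (re_le_Cmod ((x, y) - z)) as hx. pose proof (im_le_Cmod ((x, y) - z)) as hy.
  pose proof (re_le_Cmod ((x', y') - z)) as hx'. pose proof (im_le_Cmod ((x', y') - z)) as hy'.
  change (Re ((x, y) - z)) with (x - Re z) in hx.
  change (Im ((x, y) - z)) with (y - Im z) in hy.
  change (Re ((x', y') - z)) with (x' - Re z) in hx'.
  change (Im ((x', y') - z)) with (y' - Im z) in hy'.
  specialize (K1 x y x' y' ltac:(lra) ltac:(lra) ltac:(lra) ltac:(lra)).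
  specialize (K2 x y x' y' ltac:(lra) ltac:(lra) ltac:(lra) ltac:(lra)).
  pose proof (re_le_Cmod ((x', y') - (x, y))) as hr.
  pose proof (im_le_Cmod ((x', y') - (x, y))) as hi.
  change (Re ((x', y') - (x, y))) with (x' - x) in hr.
  change (Im ((x', y') - (x, y))) with (y' - y) in hi.
  eapply Rle_trans; [apply Cmod_le_Rabs|].
  set (N := (F (x', y') - F (x, y) - _)%C).
  assert (EN : N = (Re (F (x', y')) - Re (F (x, y))
      - Derive (fun s => Re (F (s, Im z))) (Re z) * (x' - x)
      - Derive (fun s => Re (F (Re z, s))) (Im z) * (y' - y),
    Im (F (x', y')) - Im (F (x, y))
      - Derive (fun s => Im (F (s, Im z))) (Re z) * (x' - x)
      - Derive (fun s => Im (F (Re z, s))) (Im z) * (y' - y))).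
  (* This is the identity F_z h + F_zbar conj h = F_x Re h + F_y Im h, written in coordinates. *)
  { unfold N, real_linear, deriv_z, deriv_zbar, deriv_x, deriv_y.
    generalize (Derive (fun s => Re (F (s, Im z))) (Re z))
      (Derive (fun s => Im (F (s, Im z))) (Re z))
      (Derive (fun s => Re (F (Re z, s))) (Im z))
      (Derive (fun s => Im (F (Re z, s))) (Im z)). intros.
    apply injective_projections; unfold Re, Im; simpl; field. }
  rewrite EN.
  change (Rabs (Re (F (x', y')) - Re (F (x, y))
      - Derive (fun s => Re (F (s, Im z))) (Re z) * (x' - x)
      - Derive (fun s => Re (F (Re z, s))) (Im z) * (y' - y)) +
    Rabs (Im (F (x', y')) - Im (F (x, y))
      - Derive (fun s => Im (F (s, Im z))) (Re z) * (x' - x)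
      - Derive (fun s => Im (F (Re z, s))) (Im z) * (y' - y))
    <= eps * Cmod ((x', y') - (x, y))).
  nra.
Qed.

(** * The inverse of G on its image: continuity and differentiability *)

(** The inverse is a total function whose values off the image are arbitrary. For univalent G it is
    two-sided on the disk. *)
Definition right_inverse_on_image (G H : C -> C) : Prop :=
  forall w, image_disk G w -> disk (H w) /\ G (H w) = w.

Lemma right_inverse_exists (G : C -> C) : exists H, right_inverse_on_image G H.
Proof.
  exists (fun w => epsilon (inhabits (RtoC 0)) (fun z => disk z /\ G z = w)).
  intros w Hw. apply epsilon_spec. exact Hw.
Qed.

Lemma right_inverseK (G H : C -> C) (z : C) :
  univalent G -> right_inverse_on_image G H -> disk z -> H (G z) = z.
Proof.
  intros HG HH Hz. destruct (HH (G z)) as [h1 h2]; [now exists z|].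
  now apply HG.
Qed.

(** Local openness of G supplies a preimage of w near H w0, and univalence identifies it with H
    w. *)
Lemma inverse_continuous (G H : C -> C) (w0 : C) :
  sense_preserving G -> univalent G -> right_inverse_on_image G H ->
  image_disk G w0 ->
  forall eps, 0 < eps -> exists del, 0 < del /\
    forall w, Cmod (w - w0) < del ->
      image_disk G w /\ Cmod (H w - H w0) < eps.
Proof.
  intros [HC HJ] HU HH Hw0 eps He. destruct (HH w0 Hw0) as [Hz0 E0].
  set (z0 := H w0) in *. pose proof Hz0 as Hz1. unfold disk in Hz1.
  (* The bound 1 - |z0| keeps the preimage inside the disk. *)
  destruct (strictly_differentiable_open G z0 _ _ (HJ z0 Hz0)
    (class_C1_strictly_differentiable G z0 HC Hz0) (Rmin eps (1 - Cmod z0)))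
    as [d [Hd K]].
  { apply Rmin_pos; lra. }
  exists d. split; [exact Hd|]. intros w Hw. rewrite <- E0 in Hw.
  destruct (K w Hw) as [z [Hz Ez]].
  pose proof (Rmin_l eps (1 - Cmod z0)). pose proof (Rmin_r eps (1 - Cmod z0)).
  pose proof (Cmod_minus_lower z z0).
  assert (Dz : disk z) by (unfold disk; lra).
  split; [now exists z|].
  rewrite <- Ez, (right_inverseK G H z) by assumption. lra.
Qed.

(** With z = H w and L the differential of G at z0 = H w0, the error z - z0 - L^-1 (w - w0) equals -
    L^-1 (w - w0 - L (z - z0)), which strict differentiability makes small relative to |z - z0|. *)
Lemma inverse_differentiable (G H : C -> C) (w0 : C) :
  sense_preserving G -> univalent G -> right_inverse_on_image G H ->
  image_disk G w0 ->
  forall eps, 0 < eps -> exists del, 0 < del /\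
    forall w, Cmod (w - w0) < del ->
      Cmod (H w - H w0
            - real_linear_inv (deriv_z G (H w0)) (deriv_zbar G (H w0)) (w - w0))
        <= eps * Cmod (w - w0).
Proof.
  intros HS HU HH Hw0 eps He. destruct (HH w0 Hw0) as [Hz0 E0].
  destruct HS as [HC HJ].
  set (z0 := H w0) in *. set (a := deriv_z G z0). set (b := deriv_zbar G z0).
  assert (Hjac : 0 < Cmod a ^ 2 - Cmod b ^ 2) by exact (HJ z0 Hz0).
  destruct (real_linear_inv_bounded a b) as [M [HM HL]].
  (* The first bound lets M e |z - z0| be absorbed, giving |z - z0| <= 2 M |w - w0|; the second
     turns the resulting error 2 M^2 e |w - w0| into eps |w - w0|. *)
  set (e := Rmin (/ (2 * M)) (eps / (2 * M * M))).
  assert (He0 : 0 < e).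
  { apply Rmin_pos; [apply Rinv_0_lt_compat; lra|].
    apply Rdiv_lt_0_compat; [lra|nra]. }
  assert (He1 : M * e <= / 2).
  { apply Rle_trans with (M * / (2 * M)).
    - apply Rmult_le_compat_l; [lra|apply Rmin_l].
    - apply Req_le. field. lra. }
  assert (He2 : 2 * M * M * e <= eps).
  { apply Rle_trans with (2 * M * M * (eps / (2 * M * M))).
    - apply Rmult_le_compat_l; [nra|apply Rmin_r].
    - apply Req_le. field. lra. }
  destruct (class_C1_strictly_differentiable G z0 HC Hz0 e He0) as [d [Hd K]].
  destruct (inverse_continuous G H w0 (conj HC HJ) HU HH Hw0 d Hd) as [d' [Hd' K']].
  exists d'. split; [exact Hd'|]. intros w Hw.
  destruct (K' w Hw) as [Iw Cw]. fold z0 in Cw.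
  destruct (HH w Iw) as [Dz Ez]. set (z := H w) in *.
  assert (Hs : Cmod (w - w0 - real_linear a b (z - z0)) <= e * Cmod (z - z0)).
  { rewrite <- Ez, <- E0. apply K; [|exact Cw].
    replace (z0 - z0)%C with (RtoC 0) by ring. now rewrite Cmod_0. }
  assert (Hi : Cmod (z - z0 - real_linear_inv a b (w - w0)) <= M * (e * Cmod (z - z0))).
  { replace (z - z0 - real_linear_inv a b (w - w0))%C with
      (- real_linear_inv a b (w - w0 - real_linear a b (z - z0)))%C.
    - rewrite Cmod_opp. eapply Rle_trans; [apply HL|].
      apply Rmult_le_compat_l; [lra|exact Hs].
    - rewrite (real_linear_inv_minus a b (w - w0)), real_linear_invK by exact Hjac. ring. }
  pose proof (Cmod_minus_lower (z - z0) (real_linear_inv a b (w - w0))) as Ht.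
  pose proof (HL (w - w0)%C) as Hk.
  pose proof (Cmod_ge_0 (z - z0)) as P1. pose proof (Cmod_ge_0 (w - w0)) as P2.
  assert (Hz : Cmod (z - z0) <= 2 * M * Cmod (w - w0)) by nra.
  eapply Rle_trans; [exact Hi|].
  apply Rle_trans with (M * (e * (2 * M * Cmod (w - w0)))).
  - apply Rmult_le_compat_l; [lra|]. apply Rmult_le_compat_l; lra.
  - replace (M * (e * (2 * M * Cmod (w - w0)))) with
      (2 * M * M * e * Cmod (w - w0)) by ring. nra.
Qed.

(** * The inverse of G along rays from the origin *)

(** Chain rule along t w, seen through a real-linear functional g of norm at most 1, so that one
    proof serves both [Re] and [Im]. *)
Lemma is_derive_inverse_ray (G H : C -> C) (w : C) (s : R) (g : C -> R) :
  sense_preserving G -> univalent G -> right_inverse_on_image G H ->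
  image_disk G (RtoC s * w) ->
  (forall z w, g (z - w)%C = g z - g w) -> (forall z, Rabs (g z) <= Cmod z) ->
  (forall (r : R) z, g (RtoC r * z)%C = r * g z) ->
  is_derive (fun t => g (H (RtoC t * w)%C)) s
    (g (real_linear_inv (deriv_z G (H (RtoC s * w)%C))
                        (deriv_zbar G (H (RtoC s * w)%C)) w)).
Proof.
  intros HS HU HH Hw Hsub Hle Hscal. apply is_derive_Reals. intros eps He.
  set (w0 := (RtoC s * w)%C) in *.
  pose proof (Cmod_ge_0 w) as Pw.
  (* The denominator |w| + 1 avoids a division by zero when w = 0, and the factor 2 makes the final
     inequality strict. *)
  destruct (inverse_differentiable G H w0 HS HU HH Hw (eps / (2 * (Cmod w + 1))))
    as [d [Hd K]].
  { apply Rdiv_lt_0_compat; lra. }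
  assert (Hdel : 0 < d / (Cmod w + 1)) by (apply Rdiv_lt_0_compat; lra).
  exists (mkposreal _ Hdel). simpl. intros h Hh Hhd.
  specialize (K (RtoC (s + h) * w)%C).
  replace (RtoC (s + h) * w - w0)%C with (RtoC h * w)%C in K
    by (unfold w0; rewrite RtoC_plus; ring).
  rewrite Cmod_mult, Cmod_R in K.
  assert (Hh0 : 0 < Rabs h) by now apply Rabs_pos_lt.
  assert (Hsm : Rabs h * Cmod w < d).
  { apply (Rmult_lt_compat_r (Cmod w + 1)) in Hhd; [|lra].
    replace (d / (Cmod w + 1) * (Cmod w + 1)) with d in Hhd by (field; lra). nra. }
  specialize (K Hsm).
  set (L := real_linear_inv (deriv_z G (H w0)) (deriv_zbar G (H w0))) in *.
  assert (EL : L (RtoC h * w)%C = (RtoC h * L w)%C).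
  { unfold L, real_linear_inv, real_linear. rewrite Cmult_conj, Cconj_RtoC. ring. }
  rewrite EL in K.
  pose proof (Hle (H (RtoC (s + h) * w)%C - H w0 - RtoC h * L w)%C) as Hg.
  rewrite !Hsub, Hscal in Hg.
  replace ((g (H (RtoC (s + h) * w)%C) - g (H w0)) / h - g (L w)) with
    ((g (H (RtoC (s + h) * w)%C) - g (H w0) - h * g (L w)) / h)
    by (field; exact Hh).
  unfold Rdiv at 1. rewrite Rabs_mult, Rabs_inv.
  apply Rmult_lt_reg_r with (Rabs h); [exact Hh0|].
  rewrite Rmult_assoc, Rinv_l, Rmult_1_r by lra.
  eapply Rle_lt_trans; [exact Hg|]. eapply Rle_lt_trans; [exact K|].
  rewrite (Rmult_comm (Rabs h)), <- Rmult_assoc.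
  apply Rmult_lt_compat_r; [exact Hh0|].
  replace (eps / (2 * (Cmod w + 1)) * Cmod w) with
    (eps * (Cmod w / (2 * (Cmod w + 1)))) by (field; lra).
  rewrite <- (Rmult_1_r eps) at 2. apply Rmult_lt_compat_l; [exact He|].
  apply Rmult_lt_reg_r with (2 * (Cmod w + 1)); [lra|].
  unfold Rdiv. rewrite Rmult_assoc, Rinv_l by lra. lra.
Qed.

(** The product rule for |H|^2 = Re^2 + Im^2; squaring avoids the singularity of the modulus at
    0. *)
Lemma is_derive_inverse_ray_Cmod (G H : C -> C) (w : C) (s : R) :
  sense_preserving G -> univalent G -> right_inverse_on_image G H ->
  image_disk G (RtoC s * w) ->
  is_derive (fun t => Cmod (H (RtoC t * w)%C) ^ 2) s
    (2 * Re (Cconj (H (RtoC s * w)%C) *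
      real_linear_inv (deriv_z G (H (RtoC s * w)%C))
                      (deriv_zbar G (H (RtoC s * w)%C)) w)).
Proof.
  intros HS HU HH Hw.
  pose proof (is_derive_inverse_ray G H w s Re HS HU HH Hw
    ltac:(reflexivity) re_le_Cmod re_scal_l) as D1.
  pose proof (is_derive_inverse_ray G H w s Im HS HU HH Hw
    ltac:(reflexivity) im_le_Cmod im_scal_l) as D2.
  apply (is_derive_ext (fun t => Re (H (RtoC t * w)%C) * Re (H (RtoC t * w)%C)
    + Im (H (RtoC t * w)%C) * Im (H (RtoC t * w)%C))).
  { intros t. rewrite Cmod2_alt. simpl. ring. }
  set (L := real_linear_inv _ _ w) in *.
  pose proof (is_derive_mult _ _ _ _ _ D1 D1 Rmult_comm) as E1.
  pose proof (is_derive_mult _ _ _ _ _ D2 D2 Rmult_comm) as E2.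
  pose proof (is_derive_plus _ _ _ _ _ E1 E2) as E.
  match type of E with is_derive _ _ ?l =>
    replace (2 * _) with l; [exact E|] end.
  rewrite re_mult, re_conj, im_conj. unfold plus, mult; simpl. ring.
Qed.

Lemma Re_Cdiv_pos (z w : C) : w <> 0 -> 0 < Re (z / w) -> 0 < Re (z * Cconj w).
Proof.
  intros Hw H.
  assert (Hm : 0 < Cmod w ^ 2) by (apply pow_lt; now apply Cmod_gt_0).
  replace (z * Cconj w)%C with (z / w * RtoC (Cmod w ^ 2))%C.
  - rewrite re_scal_r. now apply Rmult_lt_0_compat.
  - rewrite Cmod2_conj. field. exact Hw.
Qed.

(** The quantity is half the derivative of |H (s w)|^2. Up to the positive factor s J_G it is Re (DG
    conj G), whose sign is that of Re (DG / G). *)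
Lemma inverse_ray_Cmod_derivative_pos (G H : C -> C) (w : C) (s : R) :
  sense_preserving G -> G 0 = 0 -> arg_increasing_on_circles G ->
  right_inverse_on_image G H ->
  image_disk G (RtoC s * w) -> 0 < s -> w <> 0 ->
  0 < Re (Cconj (H (RtoC s * w)%C) *
      real_linear_inv (deriv_z G (H (RtoC s * w)%C))
                      (deriv_zbar G (H (RtoC s * w)%C)) w).
Proof.
  intros [_ HJ] HG0 HA HH Hw Hs Hw0.
  destruct (HH _ Hw) as [Dz Ez]. set (z := H (RtoC s * w)%C) in *.
  assert (Hz : z <> 0).
  { intros E. rewrite E, HG0 in Ez. symmetry in Ez. revert Ez.
    apply Cmult_neq_0; [|exact Hw0]. intros E0. apply RtoC_inj in E0. lra. }
  destruct (HA z Dz Hz) as [Hn Hp]. apply Re_Cdiv_pos in Hp; [|exact Hn].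
  specialize (HJ z Dz). unfold jacobian in HJ. unfold opD in Hp.
  rewrite Ez in Hp.
  set (a := deriv_z G z) in *. set (b := deriv_zbar G z) in *.
  apply Rmult_lt_reg_l with (s * (Cmod a ^ 2 - Cmod b ^ 2)); [nra|].
  rewrite Rmult_0_r.
  (* With L h = a h + b conj h and J = |a|^2 - |b|^2, the identity
     J Re (conj z L^-1 k) = Re ((z a - conj z b) conj k) at k = G z = s w. *)
  replace (s * (Cmod a ^ 2 - Cmod b ^ 2) * _) with
    (Re ((z * a - Cconj z * b) * Cconj (RtoC s * w))); [exact Hp|].
  unfold real_linear_inv, real_linear, inv_jac.
  set (J := Cmod a ^ 2 - Cmod b ^ 2) in *.
  simpl. field. lra.
Qed.

(* The preimage under G of a ray from the origin moves away from the origin: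
   the derivative of |G^-1(t w)|^2 is 2 |G|^2 Re (DG / G) / (t J_G). *)
Lemma inverse_ray_Cmod_lt (G H : C -> C) (w : C) (s : R) :
  sense_preserving G -> G 0 = 0 -> arg_increasing_on_circles G ->
  univalent G -> starlike_set (image_disk G) -> right_inverse_on_image G H ->
  image_disk G w -> w <> 0 -> 0 < s < 1 ->
  Cmod (H (RtoC s * w)%C) < Cmod (H w).
Proof.
  intros HS HG0 HA HU Hst HH Hw Hw0 Hs.
  set (phi := fun t => Cmod (H (RtoC t * w)%C) ^ 2).
  set (dphi := fun t => 2 * Re (Cconj (H (RtoC t * w)%C) *
      real_linear_inv (deriv_z G (H (RtoC t * w)%C))
                      (deriv_zbar G (H (RtoC t * w)%C)) w)).
  assert (HD : forall t, s <= t <= 1 -> is_derive phi t (dphi t) /\ 0 < dphi t).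
  { intros t Ht. assert (Ht' : image_disk G (RtoC t * w)) by (apply Hst; [exact Hw|lra]).
    split; [now apply is_derive_inverse_ray_Cmod|].
    unfold dphi. apply Rmult_lt_0_compat; [lra|].
    apply inverse_ray_Cmod_derivative_pos; auto; lra. }
  destruct (MVT_gen phi s 1 dphi) as [c [Hc E]].
  - rewrite Rmin_left, Rmax_right by lra. intros t Ht. apply HD. lra.
  - rewrite Rmin_left, Rmax_right by lra. intros t Ht.
    apply derivable_continuous_pt, ex_derive_Reals_0. exists (dphi t). apply HD. lra.
  - rewrite Rmin_left, Rmax_right in Hc by lra.
    destruct (HD c Hc) as [_ Hpos].
    assert (Hlt : phi s < phi 1) by nra.
    unfold phi in Hlt. rewrite Cmult_1_l in Hlt.
    pose proof (Cmod_ge_0 (H (RtoC s * w)%C)). pose proof (Cmod_ge_0 (H w)). nra.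
Qed.

(** * Derivatives of a function multiplied by |z|^(2m) *)

Lemma Derive_radial (m : nat) (u v : R -> R) (x c : R) :
  locally x (fun s => v s = (s ^ 2 + c) ^ m * u s) -> ex_derive u x ->
  Derive v x = 2 * INR m * (x ^ 2 + c) ^ pred m * x * u x
               + (x ^ 2 + c) ^ m * Derive u x.
Proof.
  intros Hv Hu. rewrite (Derive_ext_loc _ _ _ Hv).
  apply is_derive_unique. auto_derive; [exact Hu|].
  change (fun x0 => u x0) with u. change (x * (x * 1)) with (x ^ 2). ring.
Qed.

Lemma Cmod_pow_even (c : C) (m : nat) :
  Cmod c ^ (2 * m) = (Re c ^ 2 + Im c ^ 2) ^ m.
Proof. now rewrite pow_mult, Cmod2_alt. Qed.

Lemma disk_lines (z : C) : disk z ->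
  locally (Re z) (fun s => disk (s, Im z)) /\
  locally (Im z) (fun s => disk (Re z, s)).
Proof.
  intros Hz.
  destruct (disk_locally_2d (fun x y => disk (x, y)) z) as [d Hd];
    [intros [x y]; easy|exact Hz|].
  split; exists d; intros s Hs; apply Hd; try exact Hs;
    rewrite Rminus_diag, Rabs_R0; apply cond_pos.
Qed.

Lemma deriv_radial (m : nat) (f G : C -> C) (z : C) :
  class_Cn 1 G -> disk z ->
  (forall w, disk w -> f w = (RtoC (Cmod w ^ (2 * m)) * G w)%C) ->
  let q := 2 * INR m * (Re z ^ 2 + Im z ^ 2) ^ pred m in
  deriv_x f z = (RtoC (q * Re z) * G z + RtoC (Cmod z ^ (2 * m)) * deriv_x G z)%C /\
  deriv_y f z = (RtoC (q * Im z) * G z + RtoC (Cmod z ^ (2 * m)) * deriv_y G z)%C.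
Proof.
  intros HG Hz Hf q. destruct (disk_lines z Hz) as [L1 L2].
  destruct (HG z Hz) as [[_ [A1 [A2 _]]] [_ [B1 [B2 _]]]].
  assert (Ez : z = (Re z, Im z)) by now destruct z.
  rewrite Cmod_pow_even.
  split; [unfold deriv_x|unfold deriv_y].
  - rewrite (Derive_radial m (fun s => Re (G (s, Im z)))
      (fun s => Re (f (s, Im z))) _ (Im z ^ 2)); [|..|exact A1].
    2:{ revert L1. apply filter_imp. intros s Hs.
      now rewrite Hf, re_scal_l, Cmod_pow_even by exact Hs. }
    rewrite (Derive_radial m (fun s => Im (G (s, Im z)))
      (fun s => Im (f (s, Im z))) _ (Im z ^ 2)); [|..|exact B1].
    2:{ revert L1. apply filter_imp. intros s Hs.
      now rewrite Hf, im_scal_l, Cmod_pow_even by exact Hs. }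
    rewrite <- Ez. fold q.
    apply injective_projections; unfold Cplus, Cmult, RtoC, Re, Im; simpl fst; simpl snd; ring.
  - rewrite (Derive_radial m (fun s => Re (G (Re z, s)))
      (fun s => Re (f (Re z, s))) _ (Re z ^ 2)); [|..|exact A2].
    2:{ revert L2. apply filter_imp. intros s Hs.
      rewrite Hf, re_scal_l, Cmod_pow_even by exact Hs.
      now rewrite (Rplus_comm (s ^ 2)). }
    rewrite (Derive_radial m (fun s => Im (G (Re z, s)))
      (fun s => Im (f (Re z, s))) _ (Re z ^ 2)); [|..|exact B2].
    2:{ revert L2. apply filter_imp. intros s Hs.
      rewrite Hf, im_scal_l, Cmod_pow_even by exact Hs.
      now rewrite (Rplus_comm (s ^ 2)). }
    rewrite <- Ez, (Rplus_comm (Im z ^ 2)). fold q.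
    apply injective_projections; unfold Cplus, Cmult, RtoC, Re, Im; simpl fst; simpl snd; ring.
Qed.

(** D is -i times the angular derivative x d/dy - y d/dx. *)
Lemma opD_cartesian (f : C -> C) (z : C) :
  opD f z = (- Ci * (RtoC (Re z) * deriv_y f z - RtoC (Im z) * deriv_x f z))%C.
Proof.
  unfold opD, deriv_z, deriv_zbar.
  generalize (deriv_x f z) (deriv_y f z). intros [a b] [c d].
  destruct z as [x y]. apply injective_projections; simpl; field.
Qed.

(** The gradient of |z|^(2m) is q (x, y), so its contributions x q y G and y q x G cancel in the
    angular derivative. *)
Lemma opD_radial (m : nat) (f G : C -> C) (z : C) :
  class_Cn 1 G -> disk z ->
  (forall w, disk w -> f w = (RtoC (Cmod w ^ (2 * m)) * G w)%C) ->
  opD f z = (RtoC (Cmod z ^ (2 * m)) * opD G z)%C.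
Proof.
  intros HG Hz Hf. rewrite !opD_cartesian.
  destruct (deriv_radial m f G z HG Hz Hf) as [-> ->].
  rewrite !RtoC_mult. ring.
Qed.

(** * Starlike sets, connectedness and neighbourhoods in the plane *)

Lemma starlike_set_0 (A : C -> Prop) :
  (exists w, A w) -> starlike_set A -> A 0.
Proof.
  intros [w Hw] HA. replace (RtoC 0) with (RtoC 0 * w)%C by ring.
  apply HA; [exact Hw|lra].
Qed.

Lemma locally_ray (A : C -> Prop) (w : C) (t : R) :
  locally (RtoC t * w)%C A -> locally t (fun s => A (RtoC s * w)%C).
Proof.
  intros [d Hd].
  pose proof (Cmod_ge_0 w) as Pw.
  assert (He : 0 < d / (Cmod w + 1)) by (apply Rdiv_lt_0_compat; [apply cond_pos|lra]).
  exists (mkposreal _ He). intros s Hs. apply Hd.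
  apply C_NormedModule_mixin_compat1.
  change (minus (RtoC s * w) (RtoC t * w))%C with (RtoC s * w - RtoC t * w)%C.
  replace (RtoC s * w - RtoC t * w)%C with (RtoC (s - t) * w)%C
    by (rewrite RtoC_minus; ring).
  rewrite Cmod_mult, Cmod_R.
  change (Rabs (s - t) < d / (Cmod w + 1)) in Hs.
  apply (Rmult_lt_compat_r (Cmod w + 1)) in Hs; [|lra].
  replace (d / (Cmod w + 1) * (Cmod w + 1)) with (pos d) in Hs by (field; lra).
  pose proof (Rabs_pos (s - t)). nra.
Qed.

(** Connectedness of [0, 1] by calculus: a locally constant function has zero derivative. *)
Lemma locally_constant_eq (chi : R -> R) :
  (forall t, 0 <= t <= 1 -> locally t (fun s => chi s = chi t)) -> chi 0 = chi 1.
Proof.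
  intros H. apply (eq_is_derive chi 0 1); [|lra]. intros t Ht.
  apply (is_derive_ext_loc (fun _ => chi t)).
  - generalize (H t Ht). apply filter_imp. now intros s ->.
  - apply (is_derive_const (K := R_AbsRing) (V := R_NormedModule)).
Qed.

(** If U and V split A with 0 in U and z in V, the indicator of V along the segment from 0 to z is
    locally constant yet goes from 0 to 1. When 0 lies in V, the roles of U and V are exchanged. *)
Lemma starlike_set_connected (A : C -> Prop) :
  open A -> starlike_set A -> connected_set A.
Proof.
  intros HA HS.
  assert (aux : forall U V : C -> Prop, open U -> open V ->
    (forall z, A z -> U z \/ V z) -> U 0 -> (exists z, A z /\ V z) ->
    exists z, A z /\ U z /\ V z).
  { intros U V HU HV HUV U0 [z [Az Vz]]. apply NNPP. intros Hno.
    assert (Hex : forall w, A w -> U w -> V w -> False).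
    { intros w H1 H2 H3. apply Hno. now exists w. }
    set (chi := fun t : R =>
      if excluded_middle_informative (V (RtoC t * z)%C) then 1 else 0).
    assert (E : chi 0 = chi 1).
    { apply locally_constant_eq. intros t Ht.
      assert (At : A (RtoC t * z)%C) by (apply HS; assumption).
      destruct (HUV _ At) as [Ut|Vt].
      (* Openness of A keeps s z in A for s near t, even where s leaves [0, 1] and starlikeness says
         nothing. *)
      - generalize (filter_and _ _ (locally_ray _ _ _ (HU _ Ut))
          (locally_ray _ _ _ (HA _ At))).
        apply filter_imp. intros s [Us As]. unfold chi.
        destruct (excluded_middle_informative (V (RtoC s * z)%C)) as [h|h];
        destruct (excluded_middle_informative (V (RtoC t * z)%C)) as [h'|h'];
          try reflexivity; exfalso; eauto.
      - generalize (locally_ray _ _ _ (HV _ Vt)).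
        apply filter_imp. intros s Vs. unfold chi.
        destruct (excluded_middle_informative (V (RtoC s * z)%C)) as [h|h];
        destruct (excluded_middle_informative (V (RtoC t * z)%C)) as [h'|h'];
          try reflexivity; exfalso; eauto. }
    revert E. unfold chi. rewrite Cmult_0_l, Cmult_1_l.
    destruct (excluded_middle_informative (V z)) as [h|h]; [|contradiction].
    destruct (excluded_middle_informative (V 0)) as [h'|h'].
    - intros _. apply (Hex 0); try assumption.
      apply starlike_set_0; [now exists z|exact HS].
    - lra. }
  intros U V HU HV HUV HAU HAV.
  assert (A0 : A 0).
  { destruct HAU as [z [Az _]]. apply starlike_set_0; [now exists z|exact HS]. }
  destruct (HUV 0 A0) as [U0|V0].
  - now apply aux.
  - destruct (aux V U) as [z [h1 [h2 h3]]]; try assumption.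
    + intros z Az. destruct (HUV z Az); tauto.
    + now exists z.
Qed.

(** Balls of the product uniform structure on [C] are squares; this lemma and the next pass between
    them and round discs. *)
Lemma locally_Cmod (A : C -> Prop) (w : C) (d : R) :
  0 < d -> (forall v, Cmod (v - w) < d -> A v) -> locally w A.
Proof.
  intros Hd H.
  assert (Hd2 : 0 < d / 2) by lra.
  exists (mkposreal _ Hd2). intros v [h1 h2]. apply H.
  eapply Rle_lt_trans; [apply Cmod_le_Rabs|].
  change (Rabs (Re (v - w)) < d / 2) in h1.
  change (Rabs (Im (v - w)) < d / 2) in h2. lra.
Qed.

Lemma Cmod_locally (A : C -> Prop) (w : C) :
  locally w A -> exists d, 0 < d /\ forall v, Cmod (v - w) < d -> A v.
Proof.
  intros [d Hd]. exists d. split; [apply cond_pos|].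
  intros v Hv. apply Hd. now apply C_NormedModule_mixin_compat1.
Qed.

(** * The map |z|^(2m) G(z): injectivity, starlike image, openness *)

(** Moving inward along a ray of the image of G decreases |G| by the factor c, and also decreases
    the modulus of the preimage. *)
Lemma radial_lt (m : nat) (G : C -> C) (z w : C) (c : R) :
  sense_preserving G -> starlike G -> disk z -> disk w -> w <> 0 ->
  G z = (RtoC c * G w)%C -> 0 < c < 1 ->
  Cmod (RtoC (Cmod z ^ (2 * m)) * G z) < Cmod (RtoC (Cmod w ^ (2 * m)) * G w).
Proof.
  intros HS (_ & HG0 & (HU & _ & Hst) & HA) Hz Hw Hw0 E Hc.
  destruct (right_inverse_exists G) as [H HH].
  destruct (HA w Hw Hw0) as [Gw _].
  assert (Hlt : Cmod z < Cmod w).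
  { rewrite <- (right_inverseK G H z HU HH Hz), <- (right_inverseK G H w HU HH Hw), E.
    apply (inverse_ray_Cmod_lt G); auto. now exists w. }
  pose proof (Cmod_ge_0 z) as Pz. pose proof (proj1 (Cmod_gt_0 _) Gw) as PG.
  rewrite E, !Cmod_mult, !Cmod_R, (Rabs_pos_eq c) by lra.
  rewrite !Rabs_pos_eq by (apply pow_le; lra).
  assert (H1 : Cmod z ^ (2 * m) <= Cmod w ^ (2 * m)) by (apply pow_incr; lra).
  assert (H2 : 0 < Cmod w ^ (2 * m)) by (apply pow_lt; lra).
  assert (c * Cmod (G w) < Cmod (G w)) by nra.
  assert (0 < c * Cmod (G w)) by (apply Rmult_lt_0_compat; lra).
  apply Rle_lt_trans with (Cmod w ^ (2 * m) * (c * Cmod (G w))).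
  - apply Rmult_le_compat_r; lra.
  - apply Rmult_lt_compat_l; lra.
Qed.

Lemma radial_neq_0 (m : nat) (G : C -> C) (z : C) :
  arg_increasing_on_circles G -> disk z -> z <> 0 ->
  (RtoC (Cmod z ^ (2 * m)) * G z)%C <> 0.
Proof.
  intros HA Hz Hz0. apply Cmult_neq_0; [|now apply HA].
  intros E. apply RtoC_inj in E. apply Cmod_gt_0 in Hz0.
  pose proof (pow_lt (Cmod z) (2 * m) Hz0). lra.
Qed.

Lemma radial_univalent (m : nat) (G : C -> C) :
  sense_preserving G -> starlike G ->
  univalent (fun z => RtoC (Cmod z ^ (2 * m)) * G z)%C.
Proof.
  intros HS Hst z w Hz Hw E. pose proof Hst as (_ & HG0 & (HU & _) & HA).
  destruct (Ceq_dec z 0) as [->|Hz0].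
  { destruct (Ceq_dec w 0) as [->|Hw0]; [reflexivity|].
    exfalso. apply (radial_neq_0 m G w HA Hw Hw0).
    rewrite <- E, HG0. ring. }
  destruct (Ceq_dec w 0) as [->|Hw0].
  { exfalso. apply (radial_neq_0 m G z HA Hz Hz0). rewrite E, HG0. ring. }
  (* Equal values place G z and G w on one ray with ratio b/a. A ratio other than 1 contradicts
     strict growth along the ray; ratio 1 is settled by univalence of G. *)
  set (a := Cmod z ^ (2 * m)) in *. set (b := Cmod w ^ (2 * m)) in *.
  assert (Pa : 0 < a) by now apply pow_lt, Cmod_gt_0.
  assert (Pb : 0 < b) by now apply pow_lt, Cmod_gt_0.
  assert (Ea : RtoC a <> 0) by (intros h; apply RtoC_inj in h; lra).
  assert (Eb : RtoC b <> 0) by (intros h; apply RtoC_inj in h; lra).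
  assert (E1 : G z = (RtoC (b / a) * G w)%C).
  { rewrite RtoC_div by lra. transitivity (RtoC a * G z / RtoC a)%C;
      [field; exact Ea|]. rewrite E. field. exact Ea. }
  assert (E2 : G w = (RtoC (a / b) * G z)%C).
  { rewrite RtoC_div by lra. transitivity (RtoC b * G w / RtoC b)%C;
      [field; exact Eb|]. rewrite <- E. field. exact Eb. }
  destruct (Rtotal_order a b) as [h|[h|h]].
  - pose proof (radial_lt m G w z (a / b) HS Hst Hw Hz Hz0 E2) as L.
    fold a b in L. rewrite E in L. destruct (Rlt_irrefl _ (L ltac:(split;
      [now apply Rdiv_lt_0_compat|apply Rmult_lt_reg_r with b; [lra|];
       unfold Rdiv; rewrite Rmult_assoc, Rinv_l by lra; lra]))).
  - apply HU; try assumption. rewrite E1, h. unfold Rdiv. rewrite Rinv_r by lra. ring.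
  - pose proof (radial_lt m G z w (b / a) HS Hst Hz Hw Hw0 E1) as L.
    fold a b in L. rewrite E in L. destruct (Rlt_irrefl _ (L ltac:(split;
      [now apply Rdiv_lt_0_compat|apply Rmult_lt_reg_r with a; [lra|];
       unfold Rdiv; rewrite Rmult_assoc, Rinv_l by lra; lra]))).
Qed.

Lemma inverse_Cmod_continuous_ray (G H : C -> C) (w : C) (s : R) :
  sense_preserving G -> univalent G -> right_inverse_on_image G H ->
  image_disk G (RtoC s * w) ->
  continuity_pt (fun t => Cmod (H (RtoC t * w)%C) ^ 2) s.
Proof.
  intros HS HU HH Hw. apply derivable_continuous_pt, ex_derive_Reals_0.
  eexists. now apply (is_derive_inverse_ray_Cmod G).
Qed.

Lemma radial_starlike_set (m : nat) (G : C -> C) :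
  sense_preserving G -> starlike G ->
  starlike_set (image_disk (fun z => RtoC (Cmod z ^ (2 * m)) * G z)%C).
Proof.
  intros HS (_ & HG0 & (HU & _ & Hst) & HA) v [z [Hz <-]] t Ht.
  destruct (right_inverse_exists G) as [H HH].
  assert (D0 : disk 0) by (unfold disk; rewrite Cmod_0; lra).
  (* The cases t = 0, t = 1 and z = 0 are settled separately because the intermediate value theorem
     used below needs strict signs at both ends. *)
  destruct (Req_dec t 0) as [->|Ht0].
  { exists (RtoC 0). split; [exact D0|]. rewrite HG0. ring. }
  destruct (Req_dec t 1) as [->|Ht1].
  { exists z. split; [exact Hz|]. ring. }
  destruct (Ceq_dec z 0) as [->|Hz0].
  { exists (RtoC 0). split; [exact D0|]. rewrite HG0. ring. }
  assert (Iz : image_disk G (G z)) by now exists z.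
  (* The image of H (s G z) is |H (s G z)|^(2m) s G z, so a zero of phi gives a preimage of t
     |z|^(2m) G z. *)
  set (phi := fun s => (Cmod (H (RtoC s * G z)%C) ^ 2) ^ m * s - t * Cmod z ^ (2 * m)).
  assert (Pz : 0 < Cmod z ^ (2 * m)) by now apply pow_lt, Cmod_gt_0.
  destruct (Ranalysis5.IVT_interv phi 0 1) as [s [Hs Es]].
  - intros s Hs. unfold phi.
    apply continuity_pt_minus; [|apply continuity_pt_const; now intros ? ?].
    apply continuity_pt_mult; [|apply continuity_pt_id].
    apply (continuity_pt_comp (fun s => Cmod (H (RtoC s * G z)%C) ^ 2) (fun x => x ^ m)).
    + apply (inverse_Cmod_continuous_ray G); auto.
    + apply derivable_continuous_pt, derivable_pt_pow.
  - lra.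
  - unfold phi. nra.
  - unfold phi. rewrite Cmult_1_l, (right_inverseK G H z), <- pow_mult by assumption.
    nra.
  - destruct (HH (RtoC s * G z)%C) as [h1 h2]; [now apply Hst|].
    exists (H (RtoC s * G z)%C). split; [exact h1|].
    rewrite h2, !Cmult_assoc, <- !RtoC_mult.
    f_equal. f_equal. unfold phi in Es. rewrite pow_mult. lra.
Qed.

Lemma radial_image_open (m : nat) (G : C -> C) :
  sense_preserving G -> starlike G ->
  open (image_disk (fun z => RtoC (Cmod z ^ (2 * m)) * G z)%C).
Proof.
  intros HS Hst. pose proof (radial_starlike_set m G HS Hst) as HSt.
  pose proof Hst as (_ & HG0 & (HU & (_ & Hop & _) & Hst') & HA).
  destruct (right_inverse_exists G) as [H HH].
  assert (D0 : disk 0) by (unfold disk; rewrite Cmod_0; lra).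
  (* By starlikeness it is enough to reach a point farther out on the ray of v. *)
  assert (scaled : forall v (l : R), 1 <= l ->
    image_disk (fun z => RtoC (Cmod z ^ (2 * m)) * G z)%C (RtoC l * v)%C ->
    image_disk (fun z => RtoC (Cmod z ^ (2 * m)) * G z)%C v).
  { intros v l Hl Hv. replace v with (RtoC (/ l) * (RtoC l * v))%C.
    - apply HSt; [exact Hv|]. split.
      + apply Rlt_le, Rinv_0_lt_compat. lra.
      + rewrite <- Rinv_1. apply Rinv_le_contravar; lra.
    - rewrite Cmult_assoc, <- RtoC_mult, Rinv_l by lra. ring. }
  intros v0 [z0 [Hz0 <-]].
  destruct (Ceq_dec z0 0) as [->|Hn0].
  (* At the origin the factor |z|^(2m) degenerates when m > 0. A lower bound eta for |H| on a small
     circle |w| = r replaces the local inverse. *)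
  - assert (I0 : image_disk G 0) by now exists (RtoC 0).
    rewrite HG0, Cmult_0_r.
    destruct (Cmod_locally _ _ (Hop (RtoC 0) I0)) as [d [Hd Kd]].
    destruct (HS) as [HC _].
    destruct (class_C1_strictly_differentiable G 0 HC D0 1 ltac:(lra)) as [e [He Ke]].
    (* The bound for the differential plus the tolerance 1: |G z| <= L |z| near 0, so |G z| = r
       forces |z| to be at least r/L or at least e. *)
    set (L := Cmod (deriv_z G 0) + Cmod (deriv_zbar G 0) + 1).
    assert (HL : 1 <= L).
    { unfold L. pose proof (Cmod_ge_0 (deriv_z G 0)).
      pose proof (Cmod_ge_0 (deriv_zbar G 0)). lra. }
    assert (Hlip : forall z, Cmod z < e -> Cmod (G z) <= L * Cmod z).
    { intros z Hz.
      specialize (Ke (RtoC 0) z). replace (RtoC 0 - RtoC 0)%C with (RtoC 0) in Ke by ring.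
      replace (z - 0)%C with z in Ke by ring. rewrite Cmod_0 in Ke.
      specialize (Ke He Hz). rewrite HG0 in Ke.
      replace (G z - 0)%C with (G z) in Ke by ring.
      pose proof (Cmod_minus_lower (G z) (real_linear (deriv_z G 0) (deriv_zbar G 0) z)).
      pose proof (real_linear_bound (deriv_z G 0) (deriv_zbar G 0) z).
      unfold L. lra. }
    set (r := d / 2).
    set (eta := Rmin e (r / L)).
    assert (Heta : 0 < eta).
    { apply Rmin_pos; [exact He|]. unfold r. apply Rdiv_lt_0_compat; lra. }
    assert (Hlow : forall w, Cmod w = r -> image_disk G w /\ eta <= Cmod (H w)).
    { intros w Hw. assert (Iw : image_disk G w).
      { apply Kd. replace (w - 0)%C with w by ring. rewrite Hw. unfold r. lra. }
      split; [exact Iw|]. apply Rnot_lt_le. intros hlt.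
      destruct (HH w Iw) as [_ Ew].
      pose proof (Rmin_l e (r / L)). pose proof (Rmin_r e (r / L)).
      pose proof (Hlip (H w) ltac:(unfold eta in hlt; lra)) as h. rewrite Ew, Hw in h.
      assert (h' : L * Cmod (H w) < L * (r / L)).
      { apply Rmult_lt_compat_l; unfold eta in hlt; lra. }
      replace (L * (r / L)) with r in h' by (field; lra). lra. }
    assert (Heta' : 0 < eta ^ (2 * m)) by now apply pow_lt.
    (* If w is v rescaled to modulus r, the image of H w is v times |H w|^(2m) r / |v|, and this
       radius makes the factor at least 1. *)
    apply (locally_Cmod _ _ (eta ^ (2 * m) * r)).
    { apply Rmult_lt_0_compat; [exact Heta'|unfold r; lra]. }
    intros v Hv. replace (v - 0)%C with v in Hv by ring.
    destruct (Ceq_dec v 0) as [->|Hv0].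
    { exists (RtoC 0). split; [exact D0|]. rewrite HG0. ring. }
    apply Cmod_gt_0 in Hv0.
    set (w := (RtoC (r / Cmod v) * v)%C).
    assert (Hr : 0 < r) by (unfold r; lra).
    assert (Hw : Cmod w = r).
    { unfold w. rewrite Cmod_mult, Cmod_R, Rabs_pos_eq.
      - field. lra.
      - apply Rlt_le, Rdiv_lt_0_compat; lra. }
    destruct (Hlow w Hw) as [Iw Lw]. destruct (HH w Iw) as [Dw Ew].
    apply (scaled v (Cmod (H w) ^ (2 * m) * (r / Cmod v))).
    + apply Rle_trans with (eta ^ (2 * m) * (r / Cmod v)).
      * apply Rmult_le_reg_r with (Cmod v); [lra|].
        replace (eta ^ (2 * m) * (r / Cmod v) * Cmod v) with (eta ^ (2 * m) * r)
          by (field; lra). lra.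
      * apply Rmult_le_compat_r; [apply Rlt_le, Rdiv_lt_0_compat; lra|].
        apply pow_incr. lra.
    + exists (H w). split; [exact Dw|]. rewrite Ew. unfold w at 2.
      rewrite RtoC_mult. ring.
  - set (Q := Cmod z0 ^ (2 * m)).
    assert (HQ : 0 < Q) by now apply pow_lt, Cmod_gt_0.
    assert (Iz : image_disk G (G z0)) by now exists z0.
    assert (G0 : G z0 <> 0) by now apply HA.
    (* A point u = c G z0 slightly beyond G z0 has a preimage of modulus greater than |z0|;
       continuity of H preserves this strict inequality near u. *)
    assert (Hc : exists c, 1 < c /\ image_disk G (RtoC c * G z0)%C).
    { destruct (locally_ray (image_disk G) (G z0) 1) as [e Ke].
      { rewrite Cmult_1_l. now apply Hop. }
      exists (1 + e / 2). pose proof (cond_pos e). split; [lra|].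
      apply Ke. change (Rabs (1 + e / 2 - 1) < e).
      rewrite Rabs_pos_eq; lra. }
    destruct Hc as [c [Hc Ic]]. set (u := (RtoC c * G z0)%C) in *.
    assert (Hinc : Cmod z0 < Cmod (H u)).
    { rewrite <- (right_inverseK G H z0 HU HH Hz0) at 1.
      replace (G z0) with (RtoC (/ c) * u)%C.
      - apply (inverse_ray_Cmod_lt G); auto.
        + unfold u. apply Cmult_neq_0; [|exact G0].
          intros h. apply RtoC_inj in h. lra.
        + split; [apply Rinv_0_lt_compat; lra|].
          rewrite <- Rinv_1. apply Rinv_lt_contravar; lra.
      - unfold u. rewrite Cmult_assoc, <- RtoC_mult, Rinv_l by lra. ring. }
    destruct (inverse_continuous G H u HS HU HH Ic (Cmod (H u) - Cmod z0))
      as [d [Hd Kd]]; [lra|].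
    (* Scaling by c/Q sends the centre Q G z0 to u and this disc into the disc of radius d about u.
       The image of H w is then v times |H w|^(2m) c / Q, a factor at least c. *)
    apply (locally_Cmod _ _ (d * Q / c)).
    { apply Rdiv_lt_0_compat; [now apply Rmult_lt_0_compat|lra]. }
    intros v Hv.
    set (w := (RtoC (c / Q) * v)%C).
    destruct (Kd w) as [Iw Cw].
    { unfold w, u. replace (RtoC (c / Q) * v - RtoC c * G z0)%C with
        (RtoC (c / Q) * (v - RtoC Q * G z0))%C.
      - assert (0 < c / Q) by (apply Rdiv_lt_0_compat; lra).
        rewrite Cmod_mult, Cmod_R, Rabs_pos_eq by lra.
        apply (Rmult_lt_compat_l (c / Q)) in Hv; [|assumption].
        replace (c / Q * (d * Q / c)) with d in Hv by (field; lra). exact Hv.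
      - rewrite RtoC_div by lra. field. intros h. apply RtoC_inj in h. lra. }
    destruct (HH w Iw) as [Dw Ew].
    assert (Hbig : Cmod z0 < Cmod (H w)).
    { pose proof (Cmod_minus_lower (H u) (H w)) as h.
      rewrite Cmod_minus_sym in h. lra. }
    apply (scaled v (Cmod (H w) ^ (2 * m) * (c / Q))).
    + assert (HQ' : Q <= Cmod (H w) ^ (2 * m)).
      { apply pow_incr. pose proof (Cmod_ge_0 z0). lra. }
      apply Rmult_le_reg_r with Q; [lra|].
      replace (Cmod (H w) ^ (2 * m) * (c / Q) * Q) with (Cmod (H w) ^ (2 * m) * c)
        by (field; lra). nra.
    + exists (H w). split; [exact Dw|]. rewrite Ew. unfold w at 2.
      rewrite RtoC_mult. ring.
Qed.

Theorem theorem2 (p : nat) (f G : C -> C)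
  (hp : (1 <= p)%nat)
  (hf : p_harmonic p f)
  (hG : harmonic G)
  (hG_sp : sense_preserving G)
  (hG_st : starlike G)
  (hfG : forall z : C, disk z ->
    f z = (RtoC (Cmod z ^ (2 * (p - 1))) * G z)%C) :
  starlike f.
Proof.
  pose proof hG_st as (HC & HG0 & _ & HA).
  assert (D0 : disk 0) by (unfold disk; rewrite Cmod_0; lra).
  set (m := (p - 1)%nat) in *.
  (* f agrees with the formula only on the disk, so the images, rather than the functions, are
     identified. *)
  set (F := fun z => (RtoC (Cmod z ^ (2 * m)) * G z)%C).
  assert (Himg : forall w, image_disk F w <-> image_disk f w).
  { intros w. split; intros [z [Hz E]]; exists z; split; auto.
    - now rewrite hfG.
    - now rewrite hfG in E. }
  assert (Hst : starlike_set (image_disk f)).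
  { intros w Hw t Ht. apply Himg. apply radial_starlike_set; auto. now apply Himg. }
  assert (Hop : open (image_disk f)).
  { apply open_ext with (1 := Himg). now apply radial_image_open. }
  split; [|split; [|split; [split; [|split; [split; [|split]|]]|]]].
  (* Class C^1 is inherited from C^(2p), since 1 <= 2p. *)
  - intros z Hz. destruct (proj1 hf z Hz) as [h1 h2].
    split; apply (ex_diff_n_m (2 * p) 1); auto; lia.
  - rewrite hfG, HG0 by exact D0. ring.
  - intros z w Hz Hw E. rewrite !hfG in E by assumption.
    now apply (radial_univalent m G).
  - exists (f (RtoC 0)). now exists (RtoC 0).
  - exact Hop.
  - now apply starlike_set_connected.
  - exact Hst.
  - intros z Hz Hz0. rewrite hfG by exact Hz.
    split; [now apply radial_neq_0|].
    rewrite (opD_radial m f G z HC Hz hfG).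
    destruct (HA z Hz Hz0) as [HGz HR].
    replace (_ / _)%C with (opD G z / G z)%C; [exact HR|].
    field. split; [exact HGz|].
    intros h. apply RtoC_inj in h. apply Cmod_gt_0 in Hz0.
    pose proof (pow_lt (Cmod z) (2 * m) Hz0). lra.
Qed.
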